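(* Let $S\in\{0,1\}$ with $p=\mathbb P(S=1)$, let $X\in\mathbb R^d$ be jointly distributed with $S$, let $\sigma>0$, and let $X^\sigma=X+\sigma Z$ with $Z\sim\mathcal N(0,I)$ independent of $X$ and $S$. Let $\mathcal H_L$ be the class of linear functions $\theta_L:\mathbb R^d\to\mathbb R$ of the form $\theta_L(x)=a^{\mathrm T}x+b$, where $a\in\mathbb R^d$ and $b\in\mathbb R$, and let $\mathcal H=\{s\circ\theta_L:\theta_L\in\mathcal H_L\}$. Then there exists $\theta_L^*=\arg\min_{\theta_L\in\mathcal H_L}\|\theta^\sigma-\theta_L\|_2^2$, $\theta_L^*(x)=(a^* )^{\mathrm T}x+b^*$, with parameters $$a^*=\mathrm{Var}(X^\sigma)^{-1}\mathrm{Cov}(X^\sigma,\theta^\sigma(X^\sigma)),\qquad b^*=\mathbb E[\theta^\sigma(X^\sigma)]-(a^* )^{\mathrm T}\mathbb E[X^\sigma],$$ such that $$\epsilon_A\le\frac14\Big[\mathrm{Var}(\theta^\sigma(X^\sigma))-\mathrm{Cov}(\theta^\sigma(X^\sigma),X^\sigma)\,\mathrm{Var}(X^\sigma)^{-1}\,\mathrm{Cov}(X^\sigma,\theta^\sigma(X^\sigma))\Big].$$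
   Context: $s(z)=1/(1+e^{-z})$ is the sigmoid function. For a function $h$ on $\mathbb R^d$, $\|h\|_2^2=\mathbb E[|h(X^\sigma)|^2]$. For $i\in\{0,1\}$, $f_i^\sigma$ is the conditional density of $X^\sigma$ given $S=i$. $\eta^\sigma(x)=\mathbb E[S\vert X^\sigma=x]=s(\theta^\sigma(x))$, where $\theta^\sigma(x)=\log\left(\frac{p f_1^\sigma(x)}{(1-p)f_0^\sigma(x)}\right)$. $h^*_{\mathcal H}=\arg\min_{h\in\mathcal H}\mathbb E[(S-h(X^\sigma))^2]$ is the minimizer of the mean-squared error over $\mathcal H$, and $\epsilon_A:=\|\eta^\sigma-h^*_{\mathcal H}\|_2^2$ is the approximation error. $\mathrm{Var}(X^\sigma)$ is the $d\times d$ covariance matrix, $\mathrm{Cov}(X^\sigma,\theta^\sigma(X^\sigma))\in\mathbb R^{d\times1}$ is a cross-covariance column vector, and $\mathrm{Cov}(\theta^\sigma(X^\sigma),X^\sigma)$ is its transpose. *)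

(* Defs.v *)
From HB Require Import structures.
From mathcomp Require Import all_boot all_order all_algebra.
From mathcomp Require Import all_classical all_reals all_analysis.

Set Implicit Arguments.
Unset Strict Implicit.
Unset Printing Implicit Defensive.
Import Order.TTheory GRing.Theory Num.Theory.
Import numFieldNormedType.Exports.

Local Open Scope classical_set_scope.
Local Open Scope ring_scope.

(* Points of R^n are tuples [n.-tuple R]; their library sigma-algebra is
   generated by the coordinates, i.e. it is the Borel one. *)

Section lebesgue_tuple.
Context (R : realType).
Local Open Scope ereal_scope.

Definition cons_tuple (n : nat) (xt : measurableTypeR R * n.-tuple R) :
  n.+1.-tuple R := [tuple of xt.1 :: xt.2].

Lemma measurable_cons_tuple n : measurable_fun setT (@cons_tuple n).
Proof. exact: (measurable_cons measurable_fst measurable_snd). Qed.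

Section step.
Variables (n : nat) (m : {sigma_finite_measure set (n.-tuple R) -> \bar R}).

Definition lebesgue_tuple_step : set (n.+1.-tuple R) -> \bar R :=
  pushforward (lebesgue_measure \x m) (@cons_tuple n).

Let pre A : measurable A -> measurable (@cons_tuple n @^-1` A).
Proof.
by move=> mA; rewrite -[X in measurable X]setTI; exact: measurable_cons_tuple.
Qed.

Let step0 : lebesgue_tuple_step set0 = 0.
Proof. by rewrite /lebesgue_tuple_step /pushforward preimage_set0 measure0. Qed.

Let step_ge0 A : 0 <= lebesgue_tuple_step A.
Proof. exact: (measure_ge0 (lebesgue_measure \x m)). Qed.

Let step_additive : semi_sigma_additive lebesgue_tuple_step.
Proof.
move=> F mF tF mUF; rewrite /lebesgue_tuple_step /pushforward preimage_bigcup.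
apply: measure_semi_sigma_additive.
- by move=> k; exact: pre.
- apply/trivIsetP => /= i j _ _ ij; rewrite -preimage_setI.
  by move/trivIsetP : tF => /(_ _ _ _ _ ij) ->//; rewrite preimage_set0.
- by rewrite -preimage_bigcup; exact: pre.
Qed.

HB.instance Definition _ := isMeasure.Build _ _ _ lebesgue_tuple_step
  step0 step_ge0 step_additive.

Let uncons (t : n.+1.-tuple R) : measurableTypeR R * n.-tuple R :=
  (thead t, [tuple of behead t]).

Let cons_tupleK (xt : measurableTypeR R * n.-tuple R) :
  uncons (cons_tuple xt) = xt.
Proof.
by case: xt => x t; rewrite /uncons /cons_tuple theadE/=; congr pair; exact: val_inj.
Qed.

Let measurable_uncons : measurable_fun setT uncons.
Proof.
apply/measurable_fun_pairP; split.
  exact: (measurable_tnth ord0).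
exact: measurable_behead.
Qed.

Let step_sigma_finite : sigma_finite setT lebesgue_tuple_step.
Proof.
have [F FT Foo] : sigma_finite setT (lebesgue_measure \x m).
  have /sigma_finiteP[F [TF ndF Foo]] := sigma_finiteT (@lebesgue_measure R).
  have /sigma_finiteP[G [TG ndG Goo]] := sigma_finiteT m.
  exists (fun n => F n `*` G n).
    rewrite -setXTT TF TG predeqE => -[x y]; split.
      move=> [/= [i _ Fix] [j _ Gjy]]; exists (maxn i j) => //; split.
      - by move: x Fix; exact/subsetPset/ndF/leq_maxl.
      - by move: y Gjy; exact/subsetPset/ndG/leq_maxr.
    by move=> [i _ []/= ? ?]; split; exists i.
  move=> k; have [? ?] := Foo k; have [? ?] := Goo k.
  split; first exact: measurableX.
  by rewrite product_measure1E// lte_mul_pinfty// ge0_fin_numE.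
exists (fun k => uncons @^-1` F k).
  by rewrite -preimage_bigcup -FT preimage_setT.
move=> k; have [mFk Fkoo] := Foo k; split.
  by rewrite -[X in measurable X]setTI; exact: measurable_uncons.
rewrite /lebesgue_tuple_step /pushforward.
rewrite (_ : _ @^-1` _ = F k)//.
by apply/seteqP; split => xt /=; rewrite cons_tupleK.
Qed.

HB.instance Definition _ := Measure_isSigmaFinite.Build _ _ _
  lebesgue_tuple_step step_sigma_finite.

End step.

Definition dirac_nil : set (0.-tuple R) -> \bar R := dirac [tuple].
HB.instance Definition _ := Measure.on dirac_nil.
Let dirac_nil_sigma_finite : sigma_finite setT dirac_nil.
Proof.
apply: fin_num_fun_sigma_finite; first by rewrite measure0.
by move=> A mA; rewrite /dirac_nil /dirac.
Qed.
HB.instance Definition _ := Measure_isSigmaFinite.Build _ _ _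
  dirac_nil dirac_nil_sigma_finite.

(* The n-fold product of the Lebesgue measure on R. *)
Fixpoint lebesgue_tuple (n : nat) :
    {sigma_finite_measure set (n.-tuple R) -> \bar R} :=
  if n is n'.+1 then lebesgue_tuple_step (lebesgue_tuple n')
  else dirac_nil.

Lemma lebesgue_tuple_box n (A : 'I_n -> set R) :
  (forall i, measurable (A i)) ->
  lebesgue_tuple n [set t | forall i, A i (tnth t i)] =
  \prod_(i < n) lebesgue_measure (A i).
Proof.
elim: n A => [|n IHn] A mA.
  rewrite big_ord0 /= /dirac_nil diracE mem_set//.
  by case.
rewrite big_ord_recl -IHn//=.
rewrite /lebesgue_tuple_step /pushforward.
rewrite (_ : _ @^-1` _ = A ord0 `*`
  [set t | forall i, A (lift ord0 i) (tnth t i)]).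
  rewrite product_measure1E//=; first exact: mA.
  rewrite (_ : mkset _ = \bigcap_(i in [set: 'I_n])
    ((@tnth n R)^~ i @^-1` A (lift ord0 i))); last first.
    by apply/seteqP; split => [t At i _|t At i]; exact: At.
  apply: fin_bigcap_measurable => // i _.
  by rewrite -[X in measurable X]setTI; exact: measurable_tnth.
apply/seteqP; split => [[x t] /= H|[x t] [/= Ax At] i].
  split; first exact: (H ord0).
  by move=> i; have := H (lift ord0 i); rewrite tnthS.
case: (unliftP ord0 i) => [j ->|->]; last exact: Ax.
by rewrite tnthS; exact: At.
Qed.

End lebesgue_tuple.

Section probability.
Context d (T : measurableType d) (R : realType) (P : probability T R).

Definition independent_RV d1 d2 (T1 : measurableType d1)
    (T2 : measurableType d2) (U : T -> T1) (V : T -> T2) :=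
  forall (A : set T1) (B : set T2), measurable A -> measurable B ->
    P (U @^-1` A `&` V @^-1` B) = (P (U @^-1` A) * P (V @^-1` B))%E.

(* Z ~ N(0, I): the coordinates of Z are i.i.d. with law N(0, 1). *)
Definition standard_gaussian n (Z : T -> n.-tuple R) :=
  forall A : 'I_n -> set R, (forall i, measurable (A i)) ->
    P [set w | forall i, A i (tnth (Z w) i)] =
    (\prod_(i < n) normal_prob 0 1 (A i))%E.

(* f is a version of the density, with respect to the Lebesgue measure, of the
   conditional law of Y given the event E. *)
Definition conditional_density n (Y : T -> n.-tuple R) (E : set T)
    (f : n.-tuple R -> R) :=
  [/\ measurable_fun setT f, (forall x, 0 <= f x) &
    forall A, measurable A ->
      P (Y @^-1` A `&` E) =
      (P E * \int[lebesgue_tuple R n]_(x in A) (f x)%:E)%E].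

(* g is a version of the regression function x |-> E[U | Y = x]. *)
Definition regression_function d1 (T1 : measurableType d1) (U : T -> R)
    (Y : T -> T1) (g : T1 -> R) :=
  [/\ measurable_fun setT g, P.-integrable setT (EFin \o (g \o Y)) &
    forall A, measurable A ->
      (\int[P]_(w in Y @^-1` A) (U w)%:E =
       \int[P]_(w in Y @^-1` A) (g (Y w))%:E)%E].

Definition covariance_mx m n (U : 'I_m -> T -> R) (V : 'I_n -> T -> R) :
    'M[R]_(m, n) :=
  \matrix_(i, j) fine (covariance P (U i) (V j)).

(* The squared norm of L^2(law of Y). *)
Definition sqnorm2 (T1 : Type) (Y : T -> T1) (h : T1 -> R) : \bar R :=
  'E_P[fun w => `|h (Y w)| ^+ 2].

Definition mse (T1 : Type) (U : T -> R) (Y : T -> T1) (h : T1 -> R) : \bar R :=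
  'E_P[fun w => (U w - h (Y w)) ^+ 2].

End probability.

Definition argmin (R : realType) (H : Type) (K : set H) (J : H -> \bar R) :
    set H :=
  [set h | K h /\ forall g, K g -> (J h <= J g)%E].

Definition sigmoid (R : realType) (z : R) : R := 1 / (1 + expR (- z)).

Definition affine (R : realType) n (a : 'cV[R]_n) (b : R) (x : n.-tuple R) : R :=
  \sum_(i < n) a i 0 * tnth x i + b.

Definition affine_class (R : realType) n : set (n.-tuple R -> R) :=
  [set t | exists a b, t = affine a b].

Definition sigmoid_class (R : realType) n : set (n.-tuple R -> R) :=
  [set h | exists2 t, affine_class t & h = @sigmoid R \o t].

Definition noisy d (T : measurableType d) (R : realType) n
    (X Z : T -> n.-tuple R) (sigma : R) (w : T) : n.-tuple R :=
  [tuple tnth (X w) i + sigma * tnth (Z w) i | i < n].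

(* Where f0 x = 0 or f1 x = 0 this is the junk value ln 0 = 0; for the densities
   of a Gaussian-smoothed variable this only happens on a null set. *)
Definition log_odds (R : realType) n (p : R) (f0 f1 : n.-tuple R -> R)
    (x : n.-tuple R) : R :=
  ln (p * f1 x / ((1 - p) * f0 x)).

(* Main.v *)
(* Independence makes the law of X + sigma Z an average of translated Gaussian
   measures. The Gaussian null sets are translation invariant, so a set that
   X + sigma Z avoids on a class of positive probability is avoided altogether.
   Applied to {f_i = 0}, this gives eta = sigmoid theta almost surely; applied to
   the complement of a hyperplane, it gives the invertibility of the covariance
   matrix. The regression residual theta - theta_L^* is then orthogonal to the
   affine functions and its variance is the bracket of the bound. Finally, the
   mean-squared error of h exceeds ||eta - h||^2 by a constant, so the minimizer
   is at least as close to eta = sigmoid theta as sigmoid theta_L^* is, and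
   sigmoid is 1/4-Lipschitz. *)
Require Import Defs.
From mathcomp Require Import all_boot all_order all_algebra.
From mathcomp Require Import all_classical all_reals all_analysis.
From mathcomp Require Import measurable_realfun.
From mathcomp Require Import ring lra.

Import Order.TTheory GRing.Theory Num.Theory.
Import numFieldNormedType.Exports.
Local Open Scope classical_set_scope.
Local Open Scope ring_scope.

(** * Integration against a density and Gaussian null sets *)

Section integral_density.
Local Open Scope ereal_scope.
Context {dT} {T : measurableType dT} {R : realType}.
Variables (mu nu : {measure set T -> \bar R}) (f : T -> R).
Hypothesis mf : measurable_fun setT f.
Hypothesis f0 : forall x, (0 <= f x)%R.
Hypothesis nuE : forall A, measurable A -> nu A = \int[mu]_(x in A) (f x)%:E.
Import HBNNSimple.

(** A simple function is a finite combination of indicators of its level sets, and on each level set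
    the claim is [nuE]. *)
Lemma nnsfun_integral_density (h : {nnsfun T >-> R}) :
  \int[nu]_x (h x)%:E = \int[mu]_x ((h x)%:E * (f x)%:E).
Proof.
have mEf : measurable_fun setT (fun x => (f x)%:E) by exact/measurable_EFinP.
have mindic r : measurable_fun setT (fun x => (r * \1_(h @^-1` [set r]) x)%:E).
  by apply/measurable_EFinP; exact: measurable_funM.
transitivity (\int[nu]_x \sum_(y \in range h) (y * \1_(h @^-1` [set y]) x)%:E).
  by apply: eq_integral => x _; rewrite fimfunE -fsumEFin.
rewrite ge0_integral_fsum//; last by move=> m y _; exact: nnfun_muleindic_ge0.
transitivity (\int[mu]_x \sum_(y \in range h)
    ((y * \1_(h @^-1` [set y]) x)%:E * (f x)%:E)); last first.
  apply: eq_integral => x _; rewrite -ge0_mule_fsuml => [|y]; last first.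
    exact: nnfun_muleindic_ge0.
  by rewrite fsumEFin// -(fimfunE _ x).
rewrite ge0_integral_fsum//; last 2 first.
- by move=> y; exact: emeasurable_funM.
- by move=> m y _; rewrite mule_ge0 ?nnfun_muleindic_ge0 ?lee_fin.
apply: eq_fsbigr => r; rewrite inE => -[x _ rE].
have r0 : (0 <= r)%R by rewrite -rE.
under eq_integral do rewrite EFinM.
under [in RHS]eq_integral do rewrite EFinM -muleA.
rewrite !ge0_integralZl//; last 3 first.
- by apply: emeasurable_funM => //; exact/measurable_EFinP.
- by move=> y _; rewrite mule_ge0// lee_fin// indicE.
- exact/measurable_EFinP.
congr (_ * _); rewrite integral_indic// setIT nuE// [LHS]integral_mkcond.
by apply: eq_integral => y _; rewrite epatch_indic muleC.
Qed.

(** Monotone convergence along simple functions increasing to [g], applied under both measures. *)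
Lemma ge0_integral_density (g : T -> \bar R) :
  measurable_fun setT g -> (forall x, 0 <= g x) ->
  \int[nu]_x g x = \int[mu]_x (g x * (f x)%:E).
Proof.
move=> mg g0; pose h := nnsfun_approx measurableT mg.
have hg x : (h n x)%:E @[n --> \oo] --> g x by exact: cvg_nnsfun_approx.
transitivity (\int[nu]_x limn (fun n => (h n x)%:E)).
  by apply: eq_integral => x _; exact/esym/cvg_lim.
rewrite monotone_convergence//; last 3 first.
- by move=> n; apply/measurable_EFinP.
- by move=> n x _; rewrite lee_fin.
- by move=> x _ a b ab; rewrite lee_fin; exact/lefP/nd_nnsfun_approx.
transitivity (\int[mu]_x limn (fun n => (h n x)%:E * (f x)%:E)); last first.
  apply: eq_integral => x _; apply/cvg_lim => //; apply: cvgeZr => //.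
rewrite monotone_convergence//; last 3 first.
- by move=> n; apply/emeasurable_funM; exact/measurable_EFinP.
- by move=> n x _; rewrite mule_ge0// lee_fin.
- move=> x _ a b ab; rewrite lee_wpmul2r ?lee_fin//.
  exact/lefP/nd_nnsfun_approx.
by congr (limn _); apply/funext => n; exact: nnsfun_integral_density.
Qed.

End integral_density.

(** A zero integral makes [f] vanish almost everywhere on [D], but [f] vanishes nowhere on [D], so
    [D] itself lies in a null set. *)
Lemma pos_integral_eq0 d (T : measurableType d) (R : realType)
    (mu : {measure set T -> \bar R}) (D : set T) (f : T -> \bar R) :
  measurable D -> measurable_fun D f -> (forall x, D x -> 0 < f x)%E ->
  (\int[mu]_(x in D) f x = 0)%E -> mu D = 0%E.
Proof.
move=> mD mf f0 intf.
have /ae_eq_integral_abs : (\int[mu]_(x in D) `|f x| = 0)%E.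
  rewrite -[RHS]intf; apply: eq_integral => x /[!inE] Dx.
  by rewrite gee0_abs// ltW// f0.
move=> /(_ mD mf) [N [mN N0 DN]].
apply/eqP; rewrite -measure_le0 -N0 le_measure ?inE//.
move=> x Dx; apply: DN => /= /(_ Dx) fx0.
by have := f0 x Dx; rewrite fx0 ltxx.
Qed.

(** * Gaussian null sets on the line *)

Section gaussian_null_sets.
Context {R : realType}.

(** The image of Lebesgue measure under a translation gives half-open intervals their length, which
    characterizes Lebesgue measure. *)
Lemma lebesgue_measureD (c : R) (A : set R) : measurable A ->
  lebesgue_measure ((fun x => x + c) @^-1` A) = lebesgue_measure A.
Proof.
move=> mA.
have mc : measurable_fun setT (fun x : measurableTypeR R => x + c : measurableTypeR R).
  exact: measurable_funD.
pose phi : {mfun measurableTypeR R >-> measurableTypeR R} := 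
    @mfun_Sub _ _ (measurableTypeR R) (measurableTypeR R) _ (mem_set mc).
apply/esym/(@lebesgue_measure_unique R (pushforward lebesgue_measure phi)) => //.
move=> _ [[a b]] _ <-; rewrite /= /pushforward.
rewrite (_ : _ @^-1` _ = `](a - c), (b - c)]%classic); last first.
  by apply/seteqP; split => x /=; rewrite !in_itv/= ltrBlDr lerBrDr.
rewrite !lebesgue_measure_itv/= !lte_fin ltrD2r.
by case: ifP => // _; rewrite -!EFinB opprB addrA subrK.
Qed.

(** The normal density is positive everywhere, so the two measures dominate each other. Null sets of
    the normal law thereby inherit translation invariance, although the law itself is not
    invariant. *)
Lemma normal_prob_eq0 (A : set R) : measurable A ->
  normal_prob 0 1 A = 0%E <-> lebesgue_measure A = 0%E.
Proof.
move=> mA; split => [NA0|lA0]; last first.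
  have /null_content_dominatesP := @normal_prob_dominates R 0 1.
  exact.
apply: (@pos_integral_eq0 _ _ _ lebesgue_measure A
  (fun x => (normal_pdf 0 1 x)%:E)) => //.
  by apply/measurable_EFinP; apply: measurable_funTS; exact: measurable_normal_pdf.
move=> x _; rewrite lte_fin /normal_pdf oner_eq0 mulr_gt0 ?expR_gt0//.
exact/normal_peak_gt0/oner_neq0.
Qed.

Lemma normal_prob_shift_eq0 (c : R) (A : set R) : measurable A ->
  normal_prob 0 1 A = 0%E -> normal_prob 0 1 ((fun x => x + c) @^-1` A) = 0%E.
Proof.
move=> mA /normal_prob_eq0 A0; apply/normal_prob_eq0.
  by rewrite -[X in measurable X]setTI; apply: measurable_funD.
by rewrite lebesgue_measureD// A0.
Qed.

End gaussian_null_sets.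

(** * Gaussian null sets in several dimensions *)

Section gaussian_tuple.
Context {R : realType}.

(** The pointwise form of [noisy], to which it is convertible. With one argument fixed it also
    serves as a translation. *)
Definition add_scaled n (c : R) (x z : n.-tuple R) : n.-tuple R :=
  [tuple tnth x i + c * tnth z i | i < n].

Lemma measurable_add_scaled n (c : R) d (T : measurableType d)
    (X Z : T -> n.-tuple R) :
  measurable_fun setT X -> measurable_fun setT Z ->
  measurable_fun setT (fun w => add_scaled n c (X w) (Z w)).
Proof.
move=> mX mZ; apply/measurable_fun_tnthP => i.
rewrite (_ : _ \o _ = fun w => tnth (X w) i + c * tnth (Z w) i); last first.
  by apply/funext => w /=; rewrite tnth_mktuple.
apply: measurable_funD.
  exact: (measurableT_comp (measurable_tnth i) mX).
by apply: measurable_funM => //; exact: (measurableT_comp (measurable_tnth i) mZ).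
Qed.

Lemma measurable_shift n (c : R) (v : n.-tuple R) (A : set (n.-tuple R)) :
  measurable A -> measurable (add_scaled n c v @^-1` A).
Proof.
move=> mA; rewrite -[X in measurable X]setTI.
apply: (measurable_add_scaled n c _ _ (cst v) id) => //.
Qed.

Definition box n (A : 'I_n -> set R) : set (n.-tuple R) :=
  [set t | forall i, A i (tnth t i)].

Lemma measurable_box n (A : 'I_n -> set R) :
  (forall i, measurable (A i)) -> measurable (box n A).
Proof.
move=> mA; rewrite (_ : box n A = \bigcap_(i in [set: 'I_n])
    ((@tnth n R)^~ i @^-1` A i)); last first.
  by apply/seteqP; split => [t At i _|t At i]; exact: At.
apply: fin_bigcap_measurable => // i _.
by rewrite -[X in measurable X]setTI; exact: measurable_tnth.
Qed.

(** A condition on a single coordinate is a box whose other sides are [setT], so the coordinates are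
    already measurable for the sigma-algebra generated by boxes. *)
Lemma measurable_tuple_boxE n :
  @measurable _ (n.-tuple R) =
  <<s [set B | exists2 A, forall i, measurable (A i) & B = box n A] >>.
Proof.
apply/seteqP; split; last first.
  apply: smallest_sub; first exact: sigma_algebra_measurable.
  by move=> _ [A mA ->]; exact: measurable_box.
pose G := [set B | exists2 A, (forall i, measurable (A i)) & B = box n A].
have mid : measurable_fun setT (id : g_sigma_algebraType G -> n.-tuple R).
  apply/measurable_fun_tnthP => i _ A mA; rewrite setTI.
  apply: sub_sigma_algebra; exists (fun j => if j == i then A else setT).
    by move=> j; case: ifP.
  apply/seteqP; split => t /=; last by move=> /(_ i); rewrite eqxx.
  by move=> At j; case: ifPn => // /eqP ->.
by move=> A mA; have := mid measurableT A mA; rewrite setTI.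
Qed.

(** Boxes are stable under intersection, contain the whole space and generate the sigma-algebra. *)
Lemma tuple_measure_unique n (m1 m2 : probability (n.-tuple R) R) :
  (forall A, (forall i, measurable (A i)) -> m1 (box n A) = m2 (box n A)) ->
  forall A, measurable A -> m1 A = m2 A.
Proof.
move=> m12 A mA.
apply: (measure_unique [set B | exists2 A, (forall i, measurable (A i)) &
  B = box n A] (fun=> setT)) => //.
- exact: measurable_tuple_boxE.
- move=> _ _ [B mB ->] [C mC ->]; exists (fun i => B i `&` C i).
    by move=> i; exact: measurableI.
  apply/seteqP; split => t; first by move=> [Bt Ct] i; split.
  by move=> BC; split => i; have [] := BC i.
- by move=> _; exists (fun=> setT) => //; apply/seteqP; split.
- by rewrite bigcup_const.
- by move=> _ [B mB ->]; exact: m12.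
- by move=> _; apply: le_lt_trans (probability_le1 m1 measurableT) _; exact: ltry.
Qed.

(** [standard_gaussian] prescribes the law on boxes only. Building that law as an iterated product
    lets translation invariance of its null sets go by induction on the dimension, one coordinate at
    a time. *)
Lemma gaussian_tuple_exists n : exists2 m : probability (n.-tuple R) R,
  (forall A, (forall i, measurable (A i)) ->
    m (box n A) = (\prod_(i < n) normal_prob 0 1 (A i))%E) &
  (forall c v A, measurable A -> m A = 0%E ->
    m ((fun t => add_scaled n c t v) @^-1` A) = 0%E).
Proof.
elim: n => [|n [m mbox mshift]].
  exists (dirac [tuple]).
    by move=> A mA; rewrite big_ord0 /= diracE mem_set//; case.
  move=> c v A mA A0; rewrite -[RHS]A0; congr (dirac _ _).
  by apply/seteqP; split => t /=; rewrite (tuple0 t) (tuple0 (add_scaled _ _ _ _)).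
pose N : probability (measurableTypeR R) R := normal_prob 0 1.
pose K : {mfun (measurableTypeR R * n.-tuple R)%type >-> n.+1.-tuple R} :=
  mfun_Sub (mem_set (@measurable_cons_tuple R n)).
have mK A : measurable A -> measurable (K @^-1` A).
  by move=> mA; rewrite -[X in measurable X]setTI; exact: (@measurable_cons_tuple R n).
exists (distribution (N \x m)%E K) => [A mA|c v A mA].
  rewrite /= /distribution /pushforward.
  rewrite (_ : _ @^-1` _ = A ord0 `*` box n (fun i => A (lift ord0 i))).
    rewrite big_ord_recl -mbox// product_measure1E//; first exact: mA.
    exact: measurable_box.
  apply/seteqP; split => [[x t] /= H|[x t] [/= Ax At] i].
    split; first exact: (H ord0).
    by move=> i; have := H (lift ord0 i); rewrite tnthS.
  case: (unliftP ord0 i) => [j ->|->]; last exact: Ax.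
  by rewrite tnthS; exact: At.
rewrite /= /distribution /pushforward /product_measure1 => A0.
case/tupleP: v => v0 v.
(* The first coordinates over which the section of [A] is not null. They form a null set, since the
   measure of [A] is the integral of the measures of its sections. *)
pose B := [set x | m (xsection (K @^-1` A) x) <> 0%E].
have mxs A'' : measurable A'' -> measurable_fun setT
    (fun x : measurableTypeR R => m (xsection (K @^-1` A'') x)).
  by move=> mA''; apply: measurable_fun_xsection; exact: mK.
have mB : measurable B.
  rewrite -[X in measurable X]setTI.
  exact: (mxs _ mA measurableT [set~ 0%E] (measurableC (emeasurable_set1 _))).
have B0 : N B = 0%E.
  apply: (@pos_integral_eq0 _ _ _ N B
    (fun x => m (xsection (K @^-1` A) x))) => //.
  - apply: measurable_funTS.
    exact: mxs.
  - by move=> x /= /eqP Bx; rewrite lt0e Bx/=.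
  - apply/eqP; rewrite eq_le integral_ge0// andbT -A0.
    apply: ge0_subset_integral => //.
    exact: mxs.
pose s x := x + c * v0.
pose A' := (fun t => add_scaled n.+1 c t [tuple of v0 :: v]) @^-1` A.
have mA' : measurable A'.
  rewrite -[X in measurable X]setTI.
  exact: (measurable_add_scaled n.+1 c _ _ id (cst [tuple of v0 :: v])).
have msB : measurable (s @^-1` B : set (measurableTypeR R)).
  by rewrite -[X in measurable X]setTI; exact: measurable_funD.
(* The section at [x] of the translate of [A] is a translate of the section of [A] at [s x]. It is
   null by induction unless [s x] is in [B], which excludes only a null set of [x]. *)
rewrite (@ge0_negligible_integral _ _ _ N setT (s @^-1` B)) //; last 2 first.
- exact: mxs.
- exact: normal_prob_shift_eq0.
apply: integral0_eq => x [_ /= sBx].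
have {}sBx : m (xsection (K @^-1` A) (s x)) = 0%E.
  exact: contrapT.
rewrite -(mshift c v _ _ sBx); last first.
  by apply: measurable_xsection; exact: mK.
suff KE t : add_scaled n.+1 c (K (x, t)) [tuple of v0 :: v] =
    K (s x, add_scaled n c t v).
  by congr (m _); apply/seteqP; split => t; rewrite /xsection/= !inE /= KE.
apply: eq_from_tnth => i; rewrite tnth_mktuple.
case: (unliftP ord0 i) => [j ->|->] //.
by rewrite !tnthS tnth_mktuple.
Qed.

End gaussian_tuple.

(** * Variables smoothed by independent Gaussian noise *)

Section gaussian_smoothing.
Context {d1 d2} {T : measurableType d1} {T' : measurableType d2} {R : realType}.
Variables (P : probability T R) (n : nat) (Z : {RV P >-> n.-tuple R}).
Variables (V : {RV P >-> T'}) (phi : T' -> n.-tuple R) (sigma : R).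
Hypothesis gZ : standard_gaussian P Z.
Hypothesis indZV : independent_RV P Z V.
Hypothesis mphi : measurable_fun setT phi.
Hypothesis sigma_neq0 : sigma != 0.
Local Notation W := (fun w => add_scaled n sigma (phi (V w)) (Z w)).

(** Since y + sigma z = x + sigma (z + (y - x) / sigma), the two preimages differ by a translation
    in [z]. *)
Lemma gaussian_shift_null (x y : n.-tuple R) (A : set (n.-tuple R)) :
  measurable A -> P (Z @^-1` (add_scaled n sigma x @^-1` A)) = 0%E ->
  P (Z @^-1` (add_scaled n sigma y @^-1` A)) = 0%E.
Proof.
move=> mA; have [m mbox mshift] := @gaussian_tuple_exists R n.
have ZE B : measurable B -> P (Z @^-1` B) = m B.
  move=> mB; apply: (tuple_measure_unique n (distribution P Z) m _ _ mB).
  by move=> C mC; rewrite mbox// -gZ.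
have mxA z := measurable_shift n sigma z _ mA.
rewrite !ZE// => xA0.
rewrite -(mshift sigma^-1 (add_scaled n (-1) y x) _ (mxA x) xA0).
congr (m _); suff yE z : add_scaled n sigma x
    (add_scaled n sigma^-1 z (add_scaled n (-1) y x)) = add_scaled n sigma y z.
  by apply/seteqP; split => z /=; rewrite yE.
by apply: eq_from_tnth => i; rewrite !tnth_mktuple; field.
Qed.

Let mC (A : set (n.-tuple R)) : measurable A -> measurable
  ((fun vz => add_scaled n sigma (phi vz.1) vz.2) @^-1` A :
    set (T' * n.-tuple R)).
Proof.
move=> mA; rewrite -[X in measurable X]setTI.
by apply: measurable_add_scaled => //; exact: measurableT_comp.
Qed.

(** By independence the joint law of [V] and [Z] is a product, and Fubini applies. Keeping [V] apart
    from [phi] allows [B] to record more than the smoothed point, such as the class label. *)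
Lemma probability_smoothing (A : set (n.-tuple R)) (B : set T') :
  measurable A -> measurable B ->
  P (W @^-1` A `&` V @^-1` B) = (\int[distribution P V]_(v in B)
    P (Z @^-1` (add_scaled n sigma (phi v) @^-1` A)))%E.
Proof.
move=> mA mB.
have mVZ : measurable_fun setT (fun w => (V w, Z w)).
  exact: measurable_fun_pair.
pose VZ : {mfun T >-> (T' * n.-tuple R)%type} := mfun_Sub (mem_set mVZ).
pose C : set (T' * n.-tuple R) :=
  (fun vz => add_scaled n sigma (phi vz.1) vz.2) @^-1` A.
have mCB : measurable (C `&` (B `*` setT)).
  by apply: measurableI; [exact: mC|exact: measurableX].
have -> : P (W @^-1` A `&` V @^-1` B) = distribution P VZ (C `&` (B `*` setT)).
  congr (P _); apply/seteqP; split => w /=; first by case.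
  by case=> ? [].
rewrite -(@product_measure_unique _ _ _ _ _ (distribution P V)
  (distribution P Z) (distribution P VZ))//; last first.
  move=> D E mD mE; rewrite muleC; rewrite -[RHS]indZV//.
  by congr (P _); rewrite setIC.
rewrite /product_measure1/= [RHS]integral_mkcond.
apply: eq_integral => v _; rewrite patchE; case: ifPn => [|] vB.
  congr (P (_ @^-1` _)); apply/seteqP; split => z; rewrite /xsection/= inE.
    by case.
  by move=> Az; split => //; split => //; rewrite inE in vB.
rewrite [X in distribution _ _ X](_ : _ = set0) ?measure0//.
apply/seteqP; split => z //; rewrite /xsection/= inE => -[_ [/= Bv _]].
by rewrite notin_setE in vB.
Qed.

(* The probability is an average over V of the Gaussian measures of the
   translates of A, which are either all zero or all positive. *)
Lemma smoothing_null (A : set (n.-tuple R)) (B : set T') :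
  measurable A -> measurable B -> P (V @^-1` B) != 0%E ->
  P (W @^-1` A `&` V @^-1` B) = 0%E ->
  forall x, P (Z @^-1` (add_scaled n sigma x @^-1` A)) = 0%E.
Proof.
move=> mA mB PB0; rewrite probability_smoothing// => int0 x.
apply: contrapT => xA; move/eqP: PB0; apply.
apply: (@pos_integral_eq0 _ _ _ (distribution P V) B _ mB _ _ int0).
  apply: measurable_funTS.
  have := @measurable_fun_xsection _ _ _ _ _ (distribution P Z) _ (mC A mA).
  congr (measurable_fun _ _); apply/funext => v /=.
  congr (P (_ @^-1` _)).
  by apply/seteqP; split => z; rewrite /xsection/= inE.
move=> v _; rewrite lt0e measure_ge0 andbT; apply/eqP => vA0; apply: xA.
exact: gaussian_shift_null vA0.
Qed.

(** Together with [smoothing_null], this extends a null event from one class to the whole space. *)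
Lemma smoothing_null_full (A : set (n.-tuple R)) : measurable A ->
  (forall x, P (Z @^-1` (add_scaled n sigma x @^-1` A)) = 0%E) ->
  P (W @^-1` A) = 0%E.
Proof.
move=> mA A0; rewrite -[W @^-1` A]setIT -(preimage_setT V).
by rewrite probability_smoothing//; apply: integral0_eq => v _; exact: A0.
Qed.

End gaussian_smoothing.

(** * Linear regression *)

Section linear_regression.
Context {disp} {T : measurableType disp} {R : realType} (P : probability T R).
Local Notation L2 := (Lfun P 2%:E).
Local Notation cov X Y := (fine (covariance P X Y)).

Let L21 (X : T -> R) : X \in L2 -> X \in Lfun P 1.
Proof. by move=> ?; rewrite Lfun_subset12 ?fin_num_measure. Qed.

Let L2D (X Z : T -> R) : X \in L2 -> Z \in L2 -> X \+ Z \in L2.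
Proof. by move=> X2 Z2; apply: (Lfun_addr_closed P (lee1n 2)).2. Qed.

Let L2B (X Z : T -> R) : X \in L2 -> Z \in L2 -> X \- Z \in L2.
Proof.
move=> X2 Z2; apply: (L2D X (\- Z)) => //.
exact: (@Lfun_oppr_closed _ _ _ P _ Z Z2).
Qed.

Let L2Z c (X : T -> R) : X \in L2 -> c \o* X \in L2.
Proof. by move=> X2; rewrite Lfun_scale// ler1n. Qed.

Lemma L2_covariance_fin_num (X Y : T -> R) : X \in L2 -> Y \in L2 ->
  covariance P X Y \is a fin_num.
Proof.
by move=> X2 Y2; apply: covariance_fin_num; rewrite ?(L21 X)// ?(L21 Y)// Lfun2_mul_Lfun1.
Qed.

Lemma L2_sqr_expectation (X : T -> R) : X \in L2 ->
  ('E_P[fun w => (X w ^+ 2)%R] = 'V_P[X] + 'E_P[X] ^+ 2)%E.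
Proof.
move=> X2; rewrite varianceE// subeK//.
by rewrite fin_numX// expectation_fin_num ?L21.
Qed.

Variables (n : nat) (U : 'I_n -> T -> R) (Y : T -> R).
Hypothesis U2 : forall i, U i \in L2.
Hypothesis Y2 : Y \in L2.

Definition affine_comb (a : 'cV[R]_n) (b : R) (w : T) : R :=
  \sum_(i < n) a i 0 * U i w + b.

(** The sum runs over an arbitrary list so that linearity of expectation and covariance can be
    proved by induction on the list. *)
Let sum_comb (s : seq 'I_n) (a : 'cV[R]_n) (w : T) : R :=
  \sum_(i <- s) a i 0 * U i w.

Let sum_comb_cons i s a :
  sum_comb (i :: s) a = (a i 0 \o* U i) \+ sum_comb s a.
Proof. by apply/funext => w; rewrite /sum_comb big_cons/= [in RHS]mulrC. Qed.

Let sum_comb_nil a : sum_comb [::] a = cst 0.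
Proof. by apply/funext => w; rewrite /sum_comb big_nil. Qed.

Let sum_comb_L2 s a : sum_comb s a \in L2.
Proof.
elim: s => [|i s IH]; first by rewrite sum_comb_nil Lfun_cst.
by rewrite sum_comb_cons L2D// L2Z.
Qed.

Let affine_combE a b :
  affine_comb a b = sum_comb (index_enum 'I_n) a \+ cst b.
Proof. by apply/funext. Qed.

Lemma affine_comb_L2 a b : affine_comb a b \in L2.
Proof. by rewrite affine_combE L2D// Lfun_cst. Qed.

Lemma covariance_affine_comb a b X : X \in L2 ->
  covariance P (affine_comb a b) X = (\sum_i a i 0 * cov (U i) X)%:E.
Proof.
move=> X2; rewrite affine_combE covarianceDl ?Lfun_cst// covariance_cst_l adde0.
elim: (index_enum _) => [|i s IH].
  by rewrite sum_comb_nil covariance_cst_l big_nil.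
rewrite sum_comb_cons covarianceDl ?L2Z// IH big_cons EFinD.
rewrite covarianceZl ?(L21 (U i))// ?(L21 X)// ?Lfun2_mul_Lfun1//.
by rewrite EFinM fineK// L2_covariance_fin_num.
Qed.

Lemma expectation_affine_comb a b :
  'E_P[affine_comb a b]%E = (\sum_i a i 0 * fine 'E_P[U i] + b)%:E.
Proof.
rewrite affine_combE expectationD ?L21 ?Lfun_cst// expectation_cst EFinD.
congr (_ + _)%E; elim: (index_enum _) => [|i s IH].
  by rewrite sum_comb_nil expectation_cst big_nil.
rewrite sum_comb_cons expectationD ?L21 ?L2Z// IH big_cons EFinD.
by rewrite expectationZl ?L21// EFinM fineK// expectation_fin_num ?L21.
Qed.

Lemma affine_combB a b a' b' w :
  affine_comb (a - a') (b - b') w = affine_comb a b w - affine_comb a' b' w.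
Proof.
rewrite /affine_comb opprD addrACA -sumrB; congr (_ + _).
by apply: eq_bigr => i _; rewrite !mxE mulrBl.
Qed.

Hypothesis U_free : forall a b,
  'E_P[fun w => (affine_comb a b w ^+ 2)%R]%E = 0%E -> a = 0.

Let M := covariance_mx P U U.
Let cUY := covariance_mx P U (fun _ : 'I_1 => Y).
Let cYU := covariance_mx P (fun _ : 'I_1 => Y) U.
Let a := invmx M *m cUY.
Let b := fine 'E_P[Y] - \sum_(i < n) a i 0 * fine 'E_P[U i].

(** A vector [v] with v M = 0 yields a linear combination of the [U i] with zero variance. Once
    centred it has zero second moment, and [U_free] gives [v = 0]. *)
Lemma covariance_mx_unit : M \in unitmx.
Proof.
rewrite unitmxE unitfE; apply/negP => /det0P[v v0 vM].
suff /(U_free v^T) :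
    ('E_P[fun w => (affine_comb v^T (- fine 'E_P[affine_comb v^T 0]) w ^+ 2)%R] = 0)%E.
  by move/(congr1 trmx); rewrite trmxK trmx0; exact/eqP.
transitivity ('V_P[affine_comb v^T 0])%E.
  rewrite /variance covariance.unlock; congr expectation; apply/funext => w /=.
  rewrite (_ : affine_comb _ _ w =
    affine_comb v^T 0 w - fine 'E_P[affine_comb v^T 0]) ?expr2//.
  by rewrite /affine_comb addr0.
rewrite /variance covariance_affine_comb ?affine_comb_L2//; congr (_%:E).
apply: big1 => i _; rewrite covarianceC covariance_affine_comb//=.
rewrite (_ : \sum_i0 _ = 0) ?mulr0//.
transitivity ((v *m M) 0 i); last by rewrite vM mxE.
by rewrite mxE; apply: eq_bigr => j _; rewrite !mxE.
Qed.

Let e w := Y w - affine_comb a b w.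

Let e_L2 : e \in L2.
Proof. by rewrite (_ : e = Y \- affine_comb a b)// L2B// affine_comb_L2. Qed.

Let cov_eU i : covariance P (U i) e = 0%E.
Proof.
rewrite covarianceC (_ : e = Y \- affine_comb a b)// covarianceBl ?affine_comb_L2//.
rewrite covariance_affine_comb// -(fineK (L2_covariance_fin_num _ _ Y2 (U2 i))).
rewrite -EFinB; congr (_%:E); apply/eqP; rewrite subr_eq0; apply/eqP.
(* The normal equations, which say exactly that the residual is uncorrelated with each [U i]. *)
have /matrixP/(_ i 0) : M *m a = cUY by rewrite /a mulKVmx// covariance_mx_unit.
rewrite !mxE covarianceC => <-; apply: eq_bigr => j _.
by rewrite !mxE mulrC covarianceC.
Qed.

Let expectation_e : 'E_P[e]%E = 0%E.
Proof.
rewrite (_ : e = Y \- affine_comb a b)// expectationB ?L21 ?affine_comb_L2//.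
rewrite expectation_affine_comb /b subrKC.
by rewrite fineK ?subee// expectation_fin_num ?L21.
Qed.

(** As [e] is uncorrelated with affine combinations, its variance equals its covariance with [Y];
    expanding [e] there gives the quadratic form. *)
Let variance_e : 'V_P[e]%E = ('V_P[Y] - ((cYU *m invmx M *m cUY) 0 0)%:E)%E.
Proof.
have cov_e c d : covariance P (affine_comb c d) e = 0%E.
  rewrite covariance_affine_comb//; congr (_%:E).
  by apply: big1 => i _; rewrite cov_eU mulr0.
rewrite /variance {1}(_ : e = Y \- affine_comb a b)// covarianceBl ?affine_comb_L2//.
rewrite cov_e// sube0 covarianceC (_ : e = Y \- affine_comb a b)//.
rewrite covarianceBl ?affine_comb_L2//; congr (_ - _)%E.
rewrite covariance_affine_comb//; congr (_%:E).
rewrite -mulmxA -/a mxE; apply: eq_bigr => i _.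
by rewrite [cYU _ _]mxE mulrC covarianceC.
Qed.

(* The residual e is centred and uncorrelated with every U i, hence orthogonal
   in L^2 to every affine combination. *)
Lemma regression_pythagoras a' b' :
  ('E_P[fun w => ((Y w - affine_comb a' b' w) ^+ 2)%R] =
   'V_P[Y] - ((cYU *m invmx M *m cUY) 0 0)%:E +
   'E_P[fun w => (affine_comb (a - a') (b - b') w ^+ 2)%R])%E.
Proof.
pose l := affine_comb (a - a') (b - b').
have l2 : l \in L2 by exact: affine_comb_L2.
transitivity ('E_P[fun w => ((e \+ l) w ^+ 2)%R])%E.
  by congr expectation; apply/funext => w /=; rewrite /l affine_combB /e subrKA.
have el2 : e \+ l \in L2 by exact: L2D.
rewrite (L2_sqr_expectation (e \+ l))// (L2_sqr_expectation l)//.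
rewrite varianceD// expectationD ?(L21 e) ?(L21 l)//.
rewrite expectation_e add0e -variance_e (covarianceC P e) /l.
rewrite covariance_affine_comb// big1 ?mule0 ?adde0 ?addeA//.
by move=> i _; rewrite cov_eU mulr0.
Qed.

(** Finiteness permits cancelling this term between extended reals when the least-squares minimizer
    is shown to be unique. *)
Lemma residual_variance_fin_num :
  ('V_P[Y] - ((cYU *m invmx M *m cUY) 0 0)%:E)%E \is a fin_num.
Proof. by rewrite -variance_e variance_fin_num. Qed.

End linear_regression.

(** * The sigmoid and the posterior probability *)

Section sigmoid.
Context {R : realType}.
Implicit Types x y : R.

Lemma sigmoid_gt0 x : 0 < sigmoid x.
Proof. by rewrite /sigmoid divr_gt0// addr_gt0// expR_gt0. Qed.

Lemma sigmoid_lt1 x : sigmoid x < 1.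
Proof.
by rewrite /sigmoid ltr_pdivrMr ?mul1r ?ltrDl ?addr_gt0 ?expR_gt0.
Qed.

Lemma is_derive_sigmoid x :
  is_derive x 1 (@sigmoid R) (sigmoid x * (1 - sigmoid x)).
Proof.
have e0 : 1 + expR (- x) != 0 by rewrite gt_eqF// addr_gt0// expR_gt0.
rewrite (_ : @sigmoid R = fun z => (1 + expR (- z))^-1); last first.
  by apply/funext => z; rewrite /sigmoid div1r.
apply: is_derive_eq.
by rewrite /GRing.scale/=; field.
Qed.

Lemma continuous_sigmoid : continuous (@sigmoid R).
Proof.
move=> x; apply/differentiable_continuous/derivable1_diffP.
by have [] := is_derive_sigmoid x.
Qed.

Lemma measurable_sigmoid : measurable_fun setT (@sigmoid R).
Proof. exact: continuous_measurable_fun continuous_sigmoid. Qed.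

(** Mean value theorem: the derivative s (1 - s) is at most 1/4, because 1/4 - s (1 - s) = (s -
    1/2)^2. *)
Lemma sigmoid_lipschitz x y : `|sigmoid x - sigmoid y| <= 4^-1 * `|x - y|.
Proof.
wlog xy : x y / y <= x.
  move=> H; have [/H//|/ltW/H] := leP y x.
  by rewrite distrC [`|y - x|]distrC.
have [z _ ->] := MVT_segment xy (fun z _ => is_derive_sigmoid z)
  (continuous_subspaceT continuous_sigmoid).
rewrite normrM ler_wpM2r// ger0_norm.
  have := sqr_ge0 (sigmoid z - 2^-1); lra.
by rewrite mulr_ge0 ?subr_ge0 ?ltW ?sigmoid_gt0 ?sigmoid_lt1.
Qed.

(** Positivity of both densities makes the argument of [ln] positive, so that [expR] undoes it. At a
    zero of either density the default values would give 1/2 instead. *)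
Lemma sigmoid_log_odds n (p : R) (f0 f1 : n.-tuple R -> R) t :
  0 < p < 1 -> 0 < f0 t -> 0 < f1 t ->
  sigmoid (log_odds p f0 f1 t) = p * f1 t / (p * f1 t + (1 - p) * f0 t).
Proof.
move=> /andP[p0 p1] f00 f10; have q0 : 0 < 1 - p by rewrite subr_gt0.
have h0 : 0 < p * f1 t by rewrite mulr_gt0.
have h1 : 0 < (1 - p) * f0 t by rewrite mulr_gt0.
have h01 : 0 < p * f1 t + (1 - p) * f0 t by rewrite addr_gt0.
rewrite /sigmoid /log_odds expRN lnK ?posrE ?divr_gt0//.
set u := p * f1 t in h0 h01 *; set v := (1 - p) * f0 t in h1 h01 *.
rewrite invf_div; field.
by rewrite !gt_eqF.
Qed.

End sigmoid.

(** * Bayes' formula for the posterior probability *)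

Section bayes_regression.
Context {disp} {T : measurableType disp} {R : realType} (P : probability T R).
Variables (n : nat) (S : {RV P >-> bool}) (Y : {RV P >-> n.-tuple R}).
Variables (p : R) (f0 f1 : n.-tuple R -> R).
Hypothesis PS1 : P (S @^-1` [set true]) = p%:E.
Hypothesis p01 : 0 < p < 1.
Hypothesis cd0 : conditional_density P Y (S @^-1` [set false]) f0.
Hypothesis cd1 : conditional_density P Y (S @^-1` [set true]) f1.
Local Open Scope ereal_scope.

Let mS (s : bool) : measurable (S @^-1` [set s]).
Proof. by rewrite -[X in measurable X]setTI; exact: measurable_funP. Qed.

(** Two changes of density: [P] restricted to the class has density an indicator with respect to
    [P], and its image under [Y] has density P(S = s) f with respect to Lebesgue measure. *)
Lemma ge0_conditional_density_integral (s : bool) (f : n.-tuple R -> R)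
    (k : n.-tuple R -> \bar R) :
  conditional_density P Y (S @^-1` [set s]) f ->
  measurable_fun setT k -> (forall y, 0 <= k y) ->
  \int[P]_w (k (Y w) * (S w == s)%:R%:E) =
  \int[lebesgue_tuple R n]_y (k y * (fine (P (S @^-1` [set s])) * f y)%:E).
Proof.
move=> [mf f_ge0 fE] mk k0.
pose c := fine (P (S @^-1` [set s])).
have c0 : (0 <= c)%R by exact: fine_ge0.
have SE : (fun w => (S w == s)%:R%:E) = (fun w => (\1_(S @^-1` [set s]) w)%:E :> \bar R).
  apply/funext => w; rewrite indicE; congr ((nat_of_bool _)%:R%:E).
  by apply/eqP/idP; rewrite inE.
transitivity (\int[mrestr P (mS s)]_w k (Y w)).
  rewrite (@ge0_integral_density _ _ _ P (mrestr P (mS s))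
    (\1_(S @^-1` [set s]))) //; last 2 first.
  - by move=> A mA; rewrite integral_indic// /mrestr setIC.
  - exact: measurableT_comp.
  by apply: eq_integral => w _; have /(congr1 (fun h => h w)) /= <- := SE.
transitivity (\int[pushforward (mrestr P (mS s)) Y]_y k y).
  by rewrite ge0_integral_pushforward.
apply: (@ge0_integral_density _ _ _ (lebesgue_tuple R n)) => //.
- exact: measurable_funM.
- by move=> y; rewrite mulr_ge0.
- move=> A mA; rewrite /= /pushforward /mrestr fE//.
  under [RHS]eq_integral do rewrite EFinM.
  rewrite ge0_integralZl_EFin//.
  + by rewrite fineK// fin_num_measure.
  + by move=> y _; rewrite lee_fin.
  + by apply/measurable_EFinP; exact: measurable_funTS.
Qed.

Lemma probability_false_event : P (S @^-1` [set false]) = (1 - p)%:E.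
Proof.
rewrite (_ : _ @^-1` _ = ~` (S @^-1` [set true])).
  by rewrite probability_setC// PS1.
by apply/seteqP; split => w /=; case: (S w).
Qed.

(* Where both densities vanish this is 0 / 0 = 0, so that the product with
   p f1 + (1 - p) f0 is p f1 everywhere; sigmoid (log_odds p f0 f1 y) has the
   same value only where both densities are positive. *)
Definition bayes_posterior (y : n.-tuple R) : R :=
  p * f1 y / (p * f1 y + (1 - p) * f0 y).

Let h1 y : (0 <= p * f1 y)%R.
Proof. by case: cd1 => _ f10 _; rewrite mulr_ge0//; case/andP: p01 => /ltW. Qed.

Let h0 y : (0 <= (1 - p) * f0 y)%R.
Proof.
case: cd0 => _ f00 _; rewrite mulr_ge0//.
by case/andP: p01 => _ /ltW; rewrite subr_ge0.
Qed.

Lemma bayes_posterior_ge0 y : (0 <= bayes_posterior y)%R.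
Proof. by rewrite /bayes_posterior divr_ge0// addr_ge0. Qed.

Lemma measurable_bayes_posterior : measurable_fun setT bayes_posterior.
Proof.
have [[mf0 _ _] [mf1 _ _]] := (cd0, cd1).
have m1 : measurable_fun setT (fun y => p * f1 y)%R by exact: measurable_funM.
have m0 : measurable_fun setT (fun y => (1 - p) * f0 y)%R.
  exact: measurable_funM.
(* The inverse is rewritten as a real power, whose measurability is known; the two agree because the
   denominator is nonnegative. *)
rewrite (_ : bayes_posterior = fun y =>
    (p * f1 y * (p * f1 y + (1 - p) * f0 y) `^ (-1))%R).
  apply: measurable_funM => //.
  apply: (measurableT_comp (measurable_powR (-1))).
  exact: measurable_funD.
by apply/funext => y; rewrite powR_inv1// addr_ge0.
Qed.

(** Splitting over the two classes, the law of [Y] has density p f1 + (1 - p) f0, and the posterior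
    times this density is p f1, the part carried by S = 1. *)
Lemma ge0_bayes_posterior_integral (k : n.-tuple R -> \bar R) :
  measurable_fun setT k -> (forall y, 0 <= k y) ->
  \int[P]_w (k (Y w) * (bayes_posterior (Y w))%:E) =
  \int[P]_w (k (Y w) * (S w)%:R%:E).
Proof.
move=> mk k0.
pose kg y := k y * (bayes_posterior y)%:E.
have mb : measurable_fun setT (fun y => (bayes_posterior y)%:E).
  by apply/measurable_EFinP; exact: measurable_bayes_posterior.
have mkg : measurable_fun setT kg by exact: emeasurable_funM.
have kg0 y : 0 <= kg y by rewrite mule_ge0// lee_fin bayes_posterior_ge0.
have mSs s : measurable_fun setT (fun w => (S w == s)%:R%:E : \bar R).
  apply/measurable_EFinP.
  by apply: (measurableT_comp (f := fun b : bool => (b == s)%:R : R)).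
transitivity (\int[P]_w (kg (Y w) * (S w == true)%:R%:E +
                         kg (Y w) * (S w == false)%:R%:E)).
  apply: eq_integral => w _; rewrite /kg.
  by case: (S w) => /=; rewrite mule1 mule0 ?adde0 ?add0e.
have mkgS s : measurable_fun setT (fun w => kg (Y w) * (S w == s)%:R%:E).
  by apply: emeasurable_funM => //; exact: measurableT_comp.
have kgS0 s w : 0 <= kg (Y w) * (S w == s)%:R%:E.
  by rewrite mule_ge0// lee_fin ler0n.
rewrite ge0_integralD//.
rewrite !(ge0_conditional_density_integral _ _ _ cd0)//.
rewrite !(ge0_conditional_density_integral _ _ _ cd1)//.
rewrite probability_false_event PS1/=.
have [[mf0 f00 _] [mf1 f10 _]] := (cd0, cd1).
have m1 : measurable_fun setT (fun y => (p * f1 y)%:E).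
  by apply/measurable_EFinP; exact: measurable_funM.
have m0 : measurable_fun setT (fun y => ((1 - p) * f0 y)%:E).
  by apply/measurable_EFinP; exact: measurable_funM.
rewrite -ge0_integralD//; last 4 first.
- by move=> y _; rewrite mule_ge0// lee_fin.
- exact: emeasurable_funM.
- by move=> y _; rewrite mule_ge0// lee_fin.
- exact: emeasurable_funM.
transitivity (\int[P]_w (k (Y w) * (S w == true)%:R%:E)); last first.
  by apply: eq_integral => w _; case: (S w).
rewrite (ge0_conditional_density_integral _ _ _ cd1)// PS1/=.
apply: eq_integral => y _; rewrite /kg -ge0_muleDr ?lee_fin//.
rewrite -muleA -EFinD -EFinM; congr (_ * _%:E).
(* If the denominator vanishes, so do both of its nonnegative summands, in particular p f1. *)
rewrite /bayes_posterior; have [D0|D0] := eqVneq (p * f1 y + (1 - p) * f0 y)%R 0%R.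
  rewrite D0 mulr0; apply/esym/eqP.
  by move/eqP: D0; rewrite paddr_eq0// => /andP[].
by rewrite divfK.
Qed.

End bayes_regression.

(** * Mean-squared error and distance to the posterior *)

Section bayes_regression_mse.
Context {disp} {T : measurableType disp} {R : realType} (P : probability T R).
Variables (n : nat) (S : {RV P >-> bool}) (Y : {RV P >-> n.-tuple R}).
Variables (p : R) (f0 f1 : n.-tuple R -> R).
Hypothesis PS1 : P (S @^-1` [set true]) = p%:E.
Hypothesis p01 : 0 < p < 1.
Hypothesis cd0 : conditional_density P Y (S @^-1` [set false]) f0.
Hypothesis cd1 : conditional_density P Y (S @^-1` [set true]) f1.
Local Notation G := (bayes_posterior n p f0 f1).
Local Notation Sr := (fun w => (S w)%:R : R).
Local Open Scope ereal_scope.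

Let mG : measurable_fun setT G.
Proof. exact: (measurable_bayes_posterior P n S Y). Qed.

Let G0 y : (0 <= G y)%R.
Proof. exact: (bayes_posterior_ge0 P n S Y). Qed.

Let mSr : measurable_fun setT Sr.
Proof. exact: (measurableT_comp (f := fun b : bool => b%:R : R)). Qed.

(** Both functions have the same integrals over every measurable set under the law of [Y], so they
    agree almost everywhere for that law; the null set is then pulled back along [Y]. *)
Lemma regression_function_bayes (eta : n.-tuple R -> R) :
  regression_function P Sr Y eta -> {ae P, forall w, eta (Y w) = G (Y w)}.
Proof.
move=> [meta ieta etaE].
have mEG : measurable_fun setT (fun y => (G y)%:E) by exact/measurable_EFinP.
have mEeta : measurable_fun setT (fun y => (eta y)%:E).
  exact/measurable_EFinP.
have : ae_eq (distribution P Y) setT (fun y => (eta y)%:E) (fun y => (G y)%:E).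
  apply: (@integral_ae_eq _ _ _ (distribution P Y)) => //.
    by apply: integrable_pushforward => //; rewrite preimage_setT.
  move=> A _ mA; rewrite integral_pushforward//; last first.
    by apply: (integrableS measurableT) => //; rewrite -[X in measurable X]setTI;
      exact: measurable_funP.
  rewrite /= -etaE// ge0_integral_pushforward//; last 2 first.
  - exact: measurable_funTS.
  - by move=> y _; rewrite lee_fin.
  have mYA : measurable (Y @^-1` A).
    by rewrite -[X in measurable X]setTI; exact: measurable_funP.
  rewrite [LHS]integral_mkcond [RHS]integral_mkcond.
  transitivity (\int[P]_w ((\1_A (Y w))%:E * (Sr w)%:E)).
    by apply: eq_integral => w _; rewrite epatch_indic muleC.
  transitivity (\int[P]_w ((\1_A (Y w))%:E * (G (Y w))%:E)); last first.
    by apply: eq_integral => w _; rewrite epatch_indic muleC.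
  apply/esym/(@ge0_bayes_posterior_integral _ _ _ P n S Y p f0 f1 PS1 p01 cd0
    cd1 (fun y => (\1_A y)%:E)) => //.
  by apply/measurable_EFinP/measurable_indic.
move=> [N [mN N0 NG]]; exists (Y @^-1` N); split => //.
  by rewrite -[X in measurable X]setTI; exact: measurable_funP.
by move=> w /= etaG; apply: NG => /= /(_ I) [].
Qed.

(** The bound 2 accommodates the cross term 2 h S. *)
Let bounded_integral_fin_num (f : T -> R) : measurable_fun setT f ->
  (forall w, 0 <= f w <= 2)%R -> \int[P]_w (f w)%:E \is a fin_num.
Proof.
move=> mf f02; rewrite ge0_fin_numE; last first.
  by apply: integral_ge0 => w _; rewrite lee_fin; have /andP[] := f02 w.
apply: (@le_lt_trans _ _ (\int[P]_w (2%R)%:E)).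
  apply: ge0_le_integral => //.
  - by move=> w _; rewrite lee_fin; have /andP[] := f02 w.
  - exact/measurable_EFinP.
  - by move=> w _; rewrite lee_fin; have /andP[] := f02 w.
by rewrite integral_cst//= (@probability_setT _ _ _ P) mule1 ltry.
Qed.

(* Adding E[2 h S] = E[2 h G] turns both sides into E[S + h^2 + G^2], as
   S^2 = S. *)
Lemma mse_bayes_posterior (h : n.-tuple R -> R) : measurable_fun setT h ->
  (forall y, 0 <= h y <= 1)%R ->
  mse P Sr Y h + \int[P]_w (G (Y w) ^+ 2)%:E =
  \int[P]_w (Sr w)%:E + sqnorm2 P Y (G \- h)%R.
Proof.
move=> mh h01.
have mhY : measurable_fun setT (h \o Y) by exact: measurableT_comp.
have mGY : measurable_fun setT (G \o Y) by exact: measurableT_comp.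
have m2hS : measurable_fun setT (fun w => 2 * h (Y w) * Sr w)%R.
  by apply: measurable_funM => //; exact: measurable_funM.
have m2hG : measurable_fun setT (fun w => 2 * h (Y w) * G (Y w))%R.
  by apply: measurable_funM => //; exact: measurable_funM.
have mSh : measurable_fun setT (fun w => (Sr w - h (Y w)) ^+ 2)%R.
  by apply: measurable_funX; exact: measurable_funB.
have mGh : measurable_fun setT (fun w => (G (Y w) - h (Y w)) ^+ 2)%R.
  by apply: measurable_funX; exact: measurable_funB.
have mG2 : measurable_fun setT (fun w => G (Y w) ^+ 2)%R.
  exact: measurable_funX.
have h0 y : (0 <= h y)%R by have /andP[] := h01 y.
have S01 w : (0 <= Sr w <= 1)%R by rewrite ler0n lern1 leq_b1.
have fin : \int[P]_w (2 * h (Y w) * Sr w)%:E \is a fin_num.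
  apply: bounded_integral_fin_num => // w.
  by have := h01 (Y w); have := S01 w; nra.
have hSG : \int[P]_w (2 * h (Y w) * G (Y w))%:E =
           \int[P]_w (2 * h (Y w) * Sr w)%:E.
  under eq_integral do rewrite EFinM; under [RHS]eq_integral do rewrite EFinM.
  apply: (@ge0_bayes_posterior_integral _ _ _ P n S Y p f0 f1 PS1 p01 cd0 cd1
    (fun y => (2 * h y)%:E)).
  - by apply/measurable_EFinP; exact: measurable_funM.
  - by move=> y; rewrite lee_fin mulr_ge0.
rewrite /mse /sqnorm2 unlock.
under [X in _ = _ + X]eq_integral do rewrite real_normK ?num_real//.
rewrite -[LHS](addeK _ fin) -[RHS](addeK _ fin); congr (_ - _)%E.
have mE (f : T -> R) : measurable_fun setT f ->
  measurable_fun setT (fun w => (f w)%:E) by move=> mf; exact/measurable_EFinP.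
rewrite -[in RHS]hSG -!ge0_integralD//; try exact: mE;
  try (by apply: emeasurable_funD; exact: mE);
  try (by move=> w _; rewrite -?EFinD lee_fin ?addr_ge0 ?sqr_ge0 ?ler0n);
  try by move=> w _; rewrite lee_fin mulr_ge0 ?ler0n// mulr_ge0.
apply: eq_integral => w _; rewrite -!EFinD/=; congr (_%:E).
by case: (S w) => /=; ring.
Qed.

(** By [mse_bayes_posterior] the two criteria differ by constants; E[S] is finite and can be
    cancelled. *)
Lemma bayes_posterior_le_mse (h h' : n.-tuple R -> R) :
  measurable_fun setT h -> (forall y, 0 <= h y <= 1)%R ->
  measurable_fun setT h' -> (forall y, 0 <= h' y <= 1)%R ->
  mse P Sr Y h <= mse P Sr Y h' ->
  sqnorm2 P Y (G \- h)%R <= sqnorm2 P Y (G \- h')%R.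
Proof.
move=> mh h01 mh' h'01 hh'.
rewrite -(@leeD2lE _ (\int[P]_w (Sr w)%:E)).
  by rewrite -!mse_bayes_posterior// leeD2r.
apply: bounded_integral_fin_num => // w.
by case: (S w); rewrite ?ler0n ?ler_nat.
Qed.

End bayes_regression_mse.

(** * The approximation error *)

Lemma measurable_affine (R : realType) n (a : 'cV[R]_n) (b : R) :
  measurable_fun setT (affine a b).
Proof.
apply: measurable_funD => //; apply: measurable_sum => i.
by apply: measurable_funM => //; exact: measurable_tnth.
Qed.

Lemma expectation_sqr_eq0 d (T : measurableType d) (R : realType)
    (P : probability T R) (f : T -> R) : measurable_fun setT f ->
  ('E_P[fun w => (f w ^+ 2)%R] = 0)%E -> P (f @^-1` [set~ 0]) = 0%E.
Proof.
move=> mf f0; have mf0 : measurable (f @^-1` [set~ 0]).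
  by rewrite -[X in measurable X]setTI; apply: mf => //; exact: measurableC.
have mf2 : measurable_fun setT (fun w => (f w ^+ 2)%:E).
  by apply/measurable_EFinP; exact: measurable_funX.
apply: (@pos_integral_eq0 _ _ _ P _ (fun w => (f w ^+ 2)%:E)) => //.
- exact: measurable_funTS.
- by move=> w /= /eqP fw; rewrite lte_fin exprn_even_gt0.
- apply/eqP; rewrite eq_le integral_ge0 ?andbT; last first.
    by move=> w _; rewrite lee_fin sqr_ge0.
  rewrite -f0 unlock; apply: ge0_subset_integral => //.
  by move=> w _; rewrite lee_fin sqr_ge0.
Qed.

(* The complement of a hyperplane orthogonal to a <> 0 and its translate by a
   cover the whole space, so the Gaussian measure cannot vanish on both. *)
Lemma gaussian_noise_free d d' (T : measurableType d) (T' : measurableType d')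
    (R : realType) (P : probability T R) n (Z : {RV P >-> n.-tuple R})
    (V : {RV P >-> T'}) (phi : T' -> n.-tuple R) (sigma : R)
    (a : 'cV[R]_n) (b : R) :
  standard_gaussian P Z -> independent_RV P Z V -> measurable_fun setT phi ->
  sigma != 0 ->
  ('E_P[fun w => (affine a b (add_scaled n sigma (phi (V w)) (Z w)) ^+ 2)%R]
    = 0)%E -> a = 0.
Proof.
move=> gZ indZV mphi s0.
pose W w := add_scaled n sigma (phi (V w)) (Z w).
have mW : measurable_fun setT W.
  by apply: measurable_add_scaled => //; exact: measurableT_comp.
have maff := measurable_affine R n a b.
move=> /(@expectation_sqr_eq0 _ _ _ _ (affine a b \o W)).
move=> /(_ (measurableT_comp maff mW)) W0.
pose A := affine a b @^-1` [set~ 0].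
have mA : measurable A.
  by rewrite -[X in measurable X]setTI; apply: maff => //; exact: measurableC.
have null : forall x, P (Z @^-1` (add_scaled n sigma x @^-1` A)) = 0%E.
  apply: (smoothing_null P n Z V phi sigma gZ indZV mphi s0 A setT) => //.
    by rewrite preimage_setT (@probability_setT _ _ _ P) onee_neq0.
  by rewrite preimage_setT setIT.
pose x0 : n.-tuple R := [tuple 0 | i < n].
pose x1 : n.-tuple R := [tuple a i 0 | i < n].
have mZA x : measurable (Z @^-1` (add_scaled n sigma x @^-1` A)).
  rewrite -[X in measurable X]setTI; apply: measurable_funP => //.
  exact: measurable_shift.
apply/eqP/negPn/negP => a0.
have : P (Z @^-1` (add_scaled n sigma x0 @^-1` A) `|`
          Z @^-1` (add_scaled n sigma x1 @^-1` A)) = 0%E.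
  by rewrite measureU0; [exact: null|exact: mZA|exact: mZA|exact: null].
rewrite (_ : _ `|` _ = setT) ?(@probability_setT _ _ _ P).
  by move/eqP; rewrite onee_eq0.
apply/seteqP; split => // w _; apply: contrapT => /not_orP[/contrapT e0 /contrapT e1].
(* The two values differ by the squared norm of [a], whatever [Z w] is, so they cannot both vanish
   when [a] is nonzero. *)
have : affine a b (add_scaled n sigma x1 (Z w)) -
    affine a b (add_scaled n sigma x0 (Z w)) = \sum_i a i 0 * a i 0.
  rewrite /affine opprD addrACA subrr addr0 -sumrB.
  by apply: eq_bigr => i _; rewrite !tnth_mktuple; ring.
rewrite e1 e0 subrr => /esym/eqP.
rewrite psumr_eq0 => [/allP aa|i _]; last by rewrite -expr2 sqr_ge0.
move/eqP: a0; apply; apply/matrixP => i j; rewrite ord1 mxE.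
have := aa i; rewrite mem_index_enum => /(_ isT) /=.
by rewrite mulf_eq0 orbb => /eqP.
Qed.

Theorem proposition3 (disp : measure_display) (T : measurableType disp)
    (R : realType) (P : probability T R) (d : nat)
    (S : {RV P >-> bool}) (X Z : {RV P >-> d.-tuple R}) (p sigma : R)
    (f0 f1 eta : d.-tuple R -> R) :
  let Sr : T -> R := fun w => (S w)%:R in
  let Xs : T -> d.-tuple R := noisy X Z sigma in
  let theta : d.-tuple R -> R := log_odds p f0 f1 in
  let Xc : 'I_d -> T -> R := fun i w => tnth (Xs w) i in
  let Th : 'I_1 -> T -> R := fun _ => theta \o Xs in
  P (S @^-1` [set true]) = p%:E ->
  0 < p < 1 ->
  0 < sigma ->
  standard_gaussian P Z ->
  independent_RV P Z (fun w => (X w, S w)) ->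
  conditional_density P Xs (S @^-1` [set false]) f0 ->
  conditional_density P Xs (S @^-1` [set true]) f1 ->
  regression_function P Sr Xs eta ->
  (forall i, Xc i \in Lfun P 2%:E) ->
  theta \o Xs \in Lfun P 2%:E ->
  exists (a : 'cV[R]_d) (b : R),
    [/\ covariance_mx P Xc Xc \in unitmx,
        a = invmx (covariance_mx P Xc Xc) *m covariance_mx P Xc Th,
        b = fine 'E_P[theta \o Xs] - \sum_(i < d) a i 0 * fine 'E_P[Xc i],
        argmin (@affine_class R d) (fun t => sqnorm2 P Xs (theta \- t)%R) =
          [set affine a b]
      & forall h, argmin (@sigmoid_class R d) (mse P Sr Xs) h ->
          (sqnorm2 P Xs (eta \- h)%R <=
           4^-1%:E * ('V_P[theta \o Xs] -
             ((covariance_mx P Th Xc *m invmx (covariance_mx P Xc Xc)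
               *m covariance_mx P Xc Th) 0 0)%:E))%E].
Proof.
move=> Sr Xs theta Xc Th PS1 p01 sigma_gt0 gZ indZ cd0 cd1 reg Xc2 Th2.
have mXS : measurable_fun setT (fun w => (X w, S w)).
  exact: measurable_fun_pair.
(* The label is kept next to [X], so that a class becomes an event on [V]; [fst] recovers the point
   to be smoothed. *)
pose V : {RV P >-> (d.-tuple R * bool)%type} := mfun_Sub (mem_set mXS).
have mfst : measurable_fun setT (@fst (d.-tuple R) bool) by [].
have mXs : measurable_fun setT Xs.
  exact: measurable_add_scaled.
pose Y : {RV P >-> d.-tuple R} := mfun_Sub (mem_set mXs).
have s0 : sigma != 0 by rewrite gt_eqF.
have Xc_free a b :
    ('E_P[fun w => (affine_comb d Xc a b w ^+ 2)%R] = 0)%E -> a = 0.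
  exact: (gaussian_noise_free _ _ _ _ _ P d Z V fst sigma a b gZ indZ mfst s0).
set a := invmx (covariance_mx P Xc Xc) *m covariance_mx P Xc Th.
pose b := fine 'E_P[theta \o Xs] - \sum_(i < d) a i 0 * fine 'E_P[Xc i].
set C := ('V_P[theta \o Xs] - _)%E.
(* The squared error of any affine function is [C] plus a nonnegative excess that vanishes at [a],
   [b]. *)
have sqE a' b' : (sqnorm2 P Xs (theta \- affine a' b')%R = C +
    'E_P[fun w => (affine_comb d Xc (a - a') (b - b') w ^+ 2)%R])%E.
  rewrite -(regression_pythagoras P d Xc (theta \o Xs) Xc2 Th2 Xc_free).
  by congr expectation; apply/funext => w; rewrite real_normK ?num_real.
have Cfin : C \is a fin_num.
  exact: (residual_variance_fin_num P d Xc (theta \o Xs) Xc2 Th2 Xc_free).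
have sqa : sqnorm2 P Xs (theta \- affine a b)%R = C.
  rewrite sqE !subrr (_ : (fun _ => _) = cst 0) ?expectation_cst ?adde0//.
  apply/funext => w; rewrite /affine_comb addr0 big1 ?expr0n// => i _.
  by rewrite mxE mul0r.
exists a, b; split => //.
- exact: (covariance_mx_unit P d Xc Xc2 Xc_free).
- apply/seteqP; split => [t [[a' [b' ->]] tmin]|_ ->] /=; last first.
    split; first by exists a, b.
    move=> _ [a' [b' ->]]; rewrite sqa sqE leeDl// expectation_ge0// => w.
    exact: sqr_ge0.
  have := tmin (affine a b) (ex_intro _ a (ex_intro _ b erefl)).
  rewrite sqa sqE -[leRHS]adde0 leeD2lE// => E0.
  (* Another minimizer has zero excess. Freeness first gives [a' = a]; what remains is the constant
     (b - b')^2, so [b' = b]. *)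
  have {}E0 : ('E_P[fun w =>
      (affine_comb d Xc (a - a') (b - b') w ^+ 2)%R] = 0)%E.
    apply/eqP; rewrite eq_le E0/= expectation_ge0// => w; exact: sqr_ge0.
  have /eqP := Xc_free _ _ E0; rewrite subr_eq0 => /eqP aE.
  move: E0; rewrite aE subrr (_ : (fun _ => _) = cst ((b - b') ^+ 2)).
    rewrite expectation_cst => -[] /eqP.
    by rewrite sqrf_eq0 subr_eq0 => /eqP ->.
  apply/funext => w; rewrite /affine_comb big1 ?add0r// => i _.
  by rewrite mxE mul0r.
move=> _ [[_ [ah [bh ->]] ->] hmin].
pose G := bayes_posterior d p f0 f1.
have msig (a' : 'cV[R]_d) b' : measurable_fun setT (@sigmoid R \o affine a' b').
  by apply: measurableT_comp; [exact: measurable_sigmoid|exact: measurable_affine].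
have sig01 a' b' (y : d.-tuple R) : 0 <= (@sigmoid R \o affine a' b') y <= 1.
  by rewrite !ltW ?sigmoid_gt0 ?sigmoid_lt1.
have mG : measurable_fun setT G by exact: (measurable_bayes_posterior P d S Y).
have meta : measurable_fun setT eta by case: reg.
have mth : measurable_fun setT (theta \o Xs).
  by have := sub_Lfun_mfun Th2; rewrite inE.
(* On its own class, [Xs] avoids the zeros of its density almost surely; Gaussian smoothing carries
   this over to both classes. *)
have null_density s f : conditional_density P Xs (S @^-1` [set s]) f ->
    P (S @^-1` [set s]) != 0%E -> P (Xs @^-1` [set y | f y = 0]) = 0%E.
  move=> [mf f_ge0 fE] Ps0.
  have mA : measurable [set y | f y = 0].
    by rewrite -[X in measurable X]setTI; exact: (mf measurableT [set 0]).
  apply: (smoothing_null_full P d Z V fst sigma indZ mfst _ mA).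
  apply: (smoothing_null P d Z V fst sigma gZ indZ mfst s0 _ (setT `*` [set s])) => //.
  - exact: measurableX.
  - rewrite (_ : _ @^-1` _ = S @^-1` [set s])//.
    by apply/seteqP; split => w /=; [case|].
  - transitivity (P (Xs @^-1` [set y | f y = 0] `&` S @^-1` [set s])).
      congr (P _); apply/seteqP; split => w /=; first by case=> ? [].
      by case.
    rewrite fE// integral0_eq ?mule0// => y /= ->.
    by [].
have PS0 := probability_false_event P S p PS1.
have [p_gt0 p_lt1] := andP p01.
have thetaG : {ae P, forall w, sigmoid (theta (Xs w)) = G (Xs w)}.
  have N0 : P (Xs @^-1` [set y | f0 y = 0]) = 0%E.
    by apply: null_density cd0 _; rewrite PS0 eqe subr_eq0 gt_eqF.
  have N1 : P (Xs @^-1` [set y | f1 y = 0]) = 0%E.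
    by apply: null_density cd1 _; rewrite PS1 eqe gt_eqF.
  have mN f : measurable_fun setT f ->
      measurable (Xs @^-1` [set y | f y = 0 :> R]).
    move=> mf; rewrite -[X in measurable X]setTI; apply: (mXs) => //.
    by rewrite -[X in measurable X]setTI; exact: (mf measurableT [set 0]).
  have [[mf0 f0_ge0 _] [mf1 f1_ge0 _]] := (cd0, cd1).
  exists (Xs @^-1` [set y | f0 y = 0] `|` Xs @^-1` [set y | f1 y = 0]); split.
  - by apply: measurableU; exact: mN.
  - by rewrite measureU0 //; exact: mN.
  move=> w /=; apply: contra_notP => /not_orP[/eqP f0w /eqP f1w].
  by rewrite sigmoid_log_odds// lt0r ?f0w ?f1w ?f0_ge0 ?f1_ge0.
have etaG := regression_function_bayes P d S Y p f0 f1 PS1 p01 cd0 cd1 eta reg.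
(* Used to pass from [eta] to the posterior [G] on the left, and from [G] to the sigmoid of [theta]
   on the right. *)
have sqnorm2_ae (u v k : T -> R) : measurable_fun setT u ->
    measurable_fun setT v -> measurable_fun setT k ->
    {ae P, forall w, u w = v w} ->
    ('E_P[fun w => (`|u w - k w| ^+ 2)%R] =
     'E_P[fun w => (`|v w - k w| ^+ 2)%R])%E.
  move=> mu mv mk uv; rewrite unlock; apply: ge0_ae_eq_integral => //.
  - apply/measurable_EFinP/measurable_funX/measurableT_comp => //.
    exact: measurable_funB.
  - apply/measurable_EFinP/measurable_funX/measurableT_comp => //.
    exact: measurable_funB.
  - move: uv => [N [mN N0 uvN]]; exists N; split => // w nuv.
    by apply: uvN => /= uvw; apply: nuv => /= _; rewrite uvw.
have mhY (a' : 'cV[R]_d) b' : measurable_fun setT ((@sigmoid R \o affine a' b') \o Xs).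
  exact: (measurableT_comp (msig a' b') mXs).
rewrite /sqnorm2 (sqnorm2_ae _ (G \o Xs) _ _ _ (mhY ah bh) etaG); last 2 first.
- exact: (measurableT_comp meta mXs).
- exact: (measurableT_comp mG mXs).
(* The minimizer is compared with one particular competitor, the sigmoid of the least-squares affine
   function. *)
have := bayes_posterior_le_mse P d S Y p f0 f1 PS1 p01 cd0 cd1 _
  (@sigmoid R \o affine a b) (msig ah bh) (sig01 ah bh) (msig a b) (sig01 a b).
move=> /(_ (hmin _ _)) H; apply: le_trans (H _) _.
  by exists (affine a b) => //; exists a, b.
rewrite /sqnorm2 -(sqnorm2_ae (fun w => sigmoid (theta (Xs w))) _ _ _ _ (mhY a b) thetaG); last 2 first.
- exact: (measurableT_comp measurable_sigmoid mth).
- exact: (measurableT_comp mG mXs).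
rewrite -sqa /sqnorm2 unlock.
have maXs : measurable_fun setT (affine a b \o Xs).
  exact: (measurableT_comp (measurable_affine R d a b) mXs).
have mE : measurable_fun setT
    (fun w => (`|theta (Xs w) - affine a b (Xs w)| ^+ 2)%:E).
  apply/measurable_EFinP/measurable_funX/measurableT_comp => //.
  exact: (measurable_funB mth maXs).
rewrite -ge0_integralZl//.
apply: ge0_le_integral => //.
- apply/measurable_EFinP/measurable_funX/measurableT_comp => //.
  apply: measurable_funB => //; exact: (measurableT_comp measurable_sigmoid mth).
- exact: emeasurable_funM.
move=> w _; rewrite lee_fin.
set u := theta (Xs w); set v := affine a b (Xs w).
rewrite -/v -/u /= -/v -/u.
(* Squaring the Lipschitz bound gives the factor 1/16, which is below the required 1/4. *)
have := sigmoid_lipschitz u v; have := normr_ge0 (sigmoid u - sigmoid v).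
have := normr_ge0 (u - v).
move: `|u - v| `|sigmoid u - sigmoid v| => A B; nra.
Qed.
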